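(* Consider an Opportunistically Stochastic Shortest Path (OSSP) problem satisfying assumptions (A1)--(A4), (A5'), (A6) of the context. Suppose there exists $\delta\ge 0$ such that, for all $x_i\in X\setminus\{t\}$ and all $a\in A_i^u$: - if $a$ is deterministic, then $C(x_i,a)\ge\delta$; - if $a$ is not deterministic, with $\mathcal{I}(a)=\{z_1,\dots,z_m\}$ and $p(x_i,a,z_j)=\xi_j>0$, then $$C(x_i,a)\ \ge\ (1-\xi_r)\,\check C(\gamma_r)+\xi_r\,\delta,\qquad \forall r\in\{1,\dots,m\},\quad m=|\mathcal{I}(a)|.$$ Then this OSSP is monotone causal and Dijkstra's method is applicable. If $\delta>0$, the OSSP is monotone $\delta$-causal and Dial's method with buckets of width $\delta$ is also applicable.
   Context: SSP: $X=\{x_1,\dots,x_n,x_{n+1}=t\}$ is a finite set of nodes with target $t$. At node $x_i$ one chooses an action $a\in A_i=A(x_i)$, pays $C(x_i,a)$, and moves to $x_j$ with probability $p_{ij}(a)=p(x_i,a,x_j)$. The target is absorbing and free: $p(t,a,t)=1$, $C(t,a)=0$. A control mapping is $\mu:X\to\bigcup_x A(x)$ with $\mu(x)\in A(x)$; a policy is a sequence of control mappings $\pi=(\mu_0,\mu_1,\dots)$; it is stationary if all $\mu_k$ equal the same $\mu$. $\mathcal{J}(x,\pi)=\mathbb{E}[\sum_{k\ge0}C(y_k,\mu_k(y_k))\mid y_0=x]$, where $y_k$ is the state after $k$ transitions; $U(x)=\inf_\pi\mathcal{J}(x,\pi)$, $U_i=U(x_i)$, $U(t)=0$. An optimal stationary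 policy attains this infimum for every $x\in X$. Assumptions: (A1) each $A_i$ is compact; (A2) $C(x_i,\cdot)$ is lower semicontinuous on $A_i$; (A3) each $p_{ij}(\cdot)$ is continuous on $A_i$; (A4) there is a policy reaching $t$ with probability 1 from every starting node; (A5') $C(x,a)>0$ for all $x\ne t$, $a\in A(x)$; (A6) $p(x,a,x)=0$ for all $x\ne t$, $a\in A(x)$. $\mathcal{I}(a)=\{x_j\in X: p_{ij}(a)>0\}$ for $a\in A_i$; $a$ is deterministic if $\mathcal{I}(a)$ is a singleton. An SSP is an OSSP if for all $i,j$: whenever some $a\in A_i$ has $p_{ij}(a)>0$, there is $\tilde a\in A_i$ with $p_{ij}(\tilde a)=1$. Relaxed actions: for $a_1,\dots,a_l\in A_i$ and a probability vector $\lambda$, the relaxed action $a_\lambda$ has $p_{ij}(a_\lambda)=\sum_r\lambda_rp_{ij}(a_r)$ and $C(x_i,a_\lambda)=\sum_r\lambda_rC(x_i,a_r)$. A relaxed action is transition-equivalent to a given pure action (or a given probability distribution on successor nodes) if it induces the same transition probabilities from $x_i$ to every $x_j\in X$. $\Lambda(\cdot)$ denotes the set of all relaxed actions transition-equivalent to a given action or distribution. An action $a\in A_i$ is probabilistically dominated if $C(x_i,a)>C(x_i,a_\lambda)$ for some $a_\lambda\in\Lambda(a)$; it is replaceable if there are $a_1,\dots,a_l\in A_i$, none individually transition-equivalent to $a$, and $\lambda$ with $a_\lambda\in\Lambda(a)$ and $C(x_i,a)=C(x_i,a_\lambda)$. $A_i^u$ is the set of useful actions: those in $A_i$ that are neither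 probabilistically dominated nor replaceable. Oblique projections: for a non-deterministic $a\in A_i$ with $\mathcal{I}(a)=\{z_1,\dots,z_m\}\subset X\setminus\{x_i\}$, $p(x_i,a,z_j)=\xi_j>0$, and $r\in\{1,\dots,m\}$, $\gamma_r=(\gamma_{r,1},\dots,\gamma_{r,m})$ is the probability distribution on $\{z_1,\dots,z_m\}$ with $\gamma_{r,r}=0$ and $\gamma_{r,j}=\xi_j/(1-\xi_r)$ for $j\ne r$. Its convexified cost is $\check C(\gamma_r)=\min_{a_\lambda\in\Lambda(\gamma_r)}C(x_i,a_\lambda)$. An SSP is monotone causal if it has an optimal stationary policy $\mu^*$ such that for all $x_i\ne t$: $p_{ij}(\mu^*(x_i))>0\Rightarrow U_i>U_j$. For $\delta>0$ it is monotone $\delta$-causal if it has an optimal stationary policy $\mu^*$ such that for all $x_i\neq t$: $p_{ij}(\mu^*(x_i))>0\Rightarrow U_i\ge U_j+\delta$. Dijkstra's method (for SSPs): maintain tentative labels $V_i$, a set $K$ of accepted nodes and $L=X\setminus K$. Start with $V(t)=0$, all other labels $+\infty$, and $t$ the first node accepted. Repeatedly move to $K$ the node $\bar x\in L$ with the smallest finite label, and for each $x_i\in L$ from which $\bar x$ is a possible successor set $V_i:=\min\bigl(V_i,\ \min\{C(x_i,a)+\sum_jp_{ij}(a)V_j : a\in A_i,\ \bar x\in\mathcal{I}(a)\subset K\}\bigr)$; stop when $L$ is empty or has no finite labels. Dial's method with bucket width $\delta>0$: the same, except that tentative labels are placed into buckets $[k\delta,(k+1)\delta)$, and at each stage all tentative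 nodes in the lowest nonempty bucket are moved to $K$ simultaneously, followed by the updates of the nodes in $L$ adjacent to them. Either method is ''applicable'' if it produces the correct value function $U$ as its output. *)

(* Defs.v *)
From HB Require Import structures.
From mathcomp Require Import all_boot all_order all_algebra.
From mathcomp Require Import all_classical all_reals all_analysis.
Set Implicit Arguments.
Unset Strict Implicit.
Unset Printing Implicit Defensive.
Import Order.TTheory GRing.Theory Num.Theory.
Import numFieldNormedType.Exports.
Local Open Scope classical_set_scope.
Local Open Scope ring_scope.

(* [act] is an ambient space containing all the action sets [actions x]; [cost]
   and [trans] are irrelevant on pairs (x, a) with a outside [actions x]. *)
Record ssp (R : realType) := SSP {
  node : finType;
  target : node;
  act : topologicalType;
  actions : node -> set act;
  cost : node -> act -> R;
  trans : node -> act -> node -> R;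
  trans_ge0 : forall x a y, actions x a -> 0 <= trans x a y;
  trans_sum1 : forall x a, actions x a -> \sum_y trans x a y = 1;
  trans_target : forall a, actions target a -> trans target a target = 1;
  cost_target : forall a, actions target a -> cost target a = 0
}.

Arguments target {R} s.

Section Definitions.
Context {R : realType} (S : ssp R).

Definition control (mu : node S -> act S) := forall x, actions x (mu x).

Definition policy (pi : nat -> node S -> act S) := forall k, control (pi k).

Definition trajectory : Type := nat -> node S.

HB.instance Definition _ := gen_eqMixin trajectory.
HB.instance Definition _ := gen_choiceMixin trajectory.
HB.instance Definition _ := isPointed.Build trajectory (fun=> target S).

Definition coordinate_events : set (set trajectory) :=
  [set E | exists k x, E = [set w | w k = x]].

Definition trajectory_space := g_sigma_algebraType coordinate_events.

Definition is_law (pi : nat -> node S -> act S) (x : node S)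
    (P : probability trajectory_space R) :=
  forall (n : nat) (w : trajectory),
    P [set y | forall k, (k <= n)%N -> y k = w k] =
    ((w 0%N == x)%:R *
     \prod_(k < n) trans (w k) (pi k (w k)) (w k.+1))%:E.

(* For an admissible policy there is exactly one probability measure
   satisfying [is_law] (Ionescu-Tulcea); the default value of [xget] is only
   used for inadmissible [pi]. *)
Definition law pi x : probability trajectory_space R :=
  xget (\d_(point : trajectory_space) : probability trajectory_space R)
       [set P | is_law pi x P].

Definition expected_cost (x : node S) (pi : nat -> node S -> act S) : \bar R :=
  (\int[law pi x]_w (\sum_(k <oo) (cost (w k) (pi k (w k)))%:E))%E.

Definition value (x : node S) : \bar R :=
  ereal_inf [set expected_cost x pi | pi in policy].

Definition optimal_stationary (mu : node S -> act S) :=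
  control mu /\ forall x, expected_cost x (fun=> mu) = value x.

Definition compact_actions := forall x : node S, compact (@actions R S x).

(* Points of [subspace A] have their neighbourhoods relative to A, and points
   outside A are isolated: this is lower semicontinuity on the action set. *)
Definition lsc_cost := forall x : node S,
  lower_semicontinuous (fun a : subspace (@actions R S x) => (cost x a)%:E).

Definition continuous_trans := forall x y : node S,
  {within @actions R S x, continuous (fun a => trans x a y)}.

Definition proper_policy_exists := exists2 pi, policy pi &
  forall x, law pi x [set w | exists k, w k = target S] = 1%E.

Definition positive_cost := forall (x : node S) a,
  x != target S -> actions x a -> 0 < cost x a.

Definition no_self_transition := forall (x : node S) a,
  x != target S -> actions x a -> trans x a x = 0.

Definition succs (x : node S) (a : act S) : {set node S} :=
  finset (fun y => 0 < trans x a y).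

Definition deterministic (x : node S) (a : act S) := #|succs x a| == 1%N.

Definition opportunistic := forall (x y : node S) a,
  actions x a -> 0 < trans x a y ->
  exists2 a', actions x a' & trans x a' y = 1.

Record relaxed := Relaxed {
  rsize : nat;
  ract : 'I_rsize -> act S;
  rweight : 'I_rsize -> R
}.

Definition relaxed_at (x : node S) (b : relaxed) :=
  [/\ forall r, actions x (@ract b r), forall r, 0 <= @rweight b r &
      \sum_r @rweight b r = 1].

Definition rtrans (x : node S) (b : relaxed) (y : node S) : R :=
  \sum_r @rweight b r * trans x (@ract b r) y.

Definition rcost (x : node S) (b : relaxed) : R :=
  \sum_r @rweight b r * cost x (@ract b r).

Definition Lambda (x : node S) (q : node S -> R) : set relaxed :=
  [set b | relaxed_at x b /\ rtrans x b =1 q].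

Definition prob_dominated (x : node S) (a : act S) :=
  exists2 b, Lambda x (trans x a) b & rcost x b < cost x a.

Definition replaceable (x : node S) (a : act S) :=
  exists b, [/\ Lambda x (trans x a) b,
                forall r, ~ (trans x (@ract b r) =1 trans x a) &
                cost x a = rcost x b].

Definition useful (x : node S) : set (act S) :=
  [set a | [/\ actions x a, ~ prob_dominated x a & ~ replaceable x a]].

(* The distribution gamma_r for z_r = z, extended by 0 outside [succs x a]. *)
Definition oblique (x : node S) (a : act S) (z y : node S) : R :=
  if y == z then 0 else trans x a y / (1 - trans x a z).

(* The minimum defining the convexified cost, with value +oo if [Lambda x q] is
   empty. *)
Definition convexified_cost (x : node S) (q : node S -> R) : \bar R :=
  ereal_inf [set (rcost x b)%:E | b in Lambda x q].

Definition monotone_causal := exists2 mu, optimal_stationary mu &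
  forall x y, x != target S -> 0 < trans x (mu x) y -> (value y < value x)%E.

Definition monotone_delta_causal (delta : R) :=
  exists2 mu, optimal_stationary mu &
  forall x y, x != target S -> 0 < trans x (mu x) y ->
    (value y + delta%:E <= value x)%E.

Record state := State { accepted : {set node S}; label : node S -> \bar R }.

(* The target carries the only finite label, so it is the first node accepted
   by either method. *)
Definition initial_state : state :=
  State finset.set0 (fun x => if x == target S then 0%E else +oo%E).

(* The value an update offers to the tentative node [x] once the nodes of [B]
   have just joined the accepted set [K].  It is +oo when no node of [B] is a
   possible successor of [x], and the update then leaves the label of [x]
   unchanged. *)
Definition candidate (K B : {set node S}) (V : node S -> \bar R) (x : node S)
    : \bar R :=
  ereal_inf [set ((cost x a)%:E + \sum_y (trans x a y)%:E * V y)%E | a in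
    [set a | [/\ actions x a, exists2 z, z \in B & z \in succs x a &
                 succs x a \subset K]]].

Definition accept (s : state) (B : {set node S}) : state :=
  let K := B :|: accepted s in
  State K (fun x => if x \in K then label s x
                    else Order.min (label s x) (candidate K B (label s) x)).

Definition dijkstra_step (s s' : state) := exists z,
  [/\ z \notin accepted s, (label s z < +oo)%E,
      forall y, y \notin accepted s -> (label s z <= label s y)%E &
      s' = accept s (finset.set1 z)].

Definition bucket (delta : R) (s : state) (k : nat) : {set node S} :=
  finset (fun y => [&& y \notin accepted s,
    ((k%:R * delta)%:E <= label s y)%E & (label s y < (k.+1%:R * delta)%:E)%E]).

Definition dial_step (delta : R) (s s' : state) := exists k,
  [/\ bucket delta s k != finset.set0,
      forall j, (j < k)%N -> bucket delta s j = finset.set0 &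
      s' = accept s (bucket delta s k)].

Definition halted (s : state) :=
  forall y, y \notin accepted s -> label s y = +oo%E.

(* Every run of [step] from the given state, whatever choices are made among
   equal labels, reaches a halted state, with final labels [W]. *)
Inductive always_outputs (step : state -> state -> Prop)
    (W : node S -> \bar R) : state -> Prop :=
| Outputs_halted s :
    halted s -> label s =1 W -> always_outputs step W s
| Outputs_step s :
    ~ halted s -> (exists s', step s s') ->
    (forall s', step s s' -> always_outputs step W s') ->
    always_outputs step W s.

Definition dijkstra_applicable :=
  always_outputs dijkstra_step value initial_state.

Definition dial_applicable (delta : R) :=
  always_outputs (dial_step delta) value initial_state.

End Definitions.

(* Main.v *)
Require Import Defs.
From HB Require Import structures.
From mathcomp Require Import all_boot all_order all_algebra.
From mathcomp Require Import all_classical all_reals all_analysis.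
From mathcomp Require Import measurable_realfun.
From mathcomp Require Import ring lra.
Import Order.TTheory GRing.Theory Num.Theory.
Import numFieldNormedType.Exports.
Local Open Scope classical_set_scope.
Local Open Scope ring_scope.
Set Implicit Arguments.
Unset Strict Implicit.
Unset Printing Implicit Defensive.

(** The value function [U] is the limit of value iteration from 0.  Opportunism
    turns a path to the target into a deterministic route, so the iterates stay
    bounded ([iterate_bounded]); compactness of the action sets provides actions
    that are greedy for the limit ([limit_value_attained]); the iterates bound
    the finite-horizon costs of every policy from below, and the limit bounds
    those of a greedy stationary policy from above.  Hence [U = value] and every
    greedy stationary policy is optimal ([valueE], [greedy_optimal]).  These
    costs are integrals over trajectories.  They reduce to sums of finite
    expectations ([expected_costE]) because a policy does have a law: it is the
    image of the uniform measure on [0, 1[ under the decoding of a number by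
    nested intervals ([is_law_exists]).

    The core is [causal_action].  If removing a successor [z] of probability
    [xi] from an optimal action leaves a distribution realized by a relaxed
    action, the Bellman inequality for that relaxed action bounds [U x] by the
    convexified cost plus the mean value of the other successors; combined with
    the assumed lower bound on [cost x a], this gives
    [xi * (U z + delta) <= xi * U x].  Two points need care.  The assumption
    only concerns useful actions, so the optimal action has to be chosen
    useful: one that maximizes the squared norm of the transition vector is an
    extreme point, which excludes replaceability.  And for [delta = 0] the
    inequality must be strict: choosing the set of successors minimal among
    optimal actions forces every action avoiding [z] to be worse by a fixed
    amount, by compactness.

    Both algorithms keep the invariant [label_invariant].  A tentative node of
    smallest value is the target, labelled 0 from the start, or has only
    accepted successors under the causal policy; either way its label is correct
    ([frontier]).  For Dijkstra's method this makes the
    smallest label correct; for Dial's method, causality with gap [delta] places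
    all successors of the nodes of the lowest bucket in the accepted set. *)

(** * Functions with finitely many values *)

Section FiniteValued.
Context d (T : measurableType d) (R : realType) (I : finType).
Variables (mu : {measure set T -> \bar R}) (f : T -> I).

Lemma bigcup_fibers (E : set T) :
  \bigcup_(i in [set: I]) (E `&` [set w | f w = i]) = E.
Proof.
by apply/seteqP; split => [w [i _ []//]|w Ew]; exists (f w).
Qed.

Lemma measurable_fibers (E : set T) :
  (forall i, measurable (E `&` [set w | f w = i])) -> measurable E.
Proof.
move=> mE; rewrite -(bigcup_fibers E).
by apply: fin_bigcup_measurable => //; exact: finite_finset.
Qed.

Lemma measure_fibers (E : set T) :
  (forall i, measurable (E `&` [set w | f w = i])) ->
  mu E = (\sum_i mu (E `&` [set w | f w = i]))%E.
Proof.
move=> mE; rewrite -[in LHS](bigcup_fibers E) measure_fin_bigcup//.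
- rewrite (fsbigE (index_enum I))/= ?index_enum_uniq//.
  + by apply: eq_bigl => i; rewrite in_setT.
  + by move=> i _; rewrite mem_index_enum.
- exact: finite_finset.
- exact: trivIset_preimage1_in.
Qed.

Lemma ge0_integral_finite_valued (g : I -> R) :
  (forall i, 0 <= g i) -> (forall i, measurable [set w | f w = i]) ->
  (\int[mu]_w (g (f w))%:E = \sum_i (g i)%:E * mu [set w | f w = i])%E.
Proof.
move=> g0 mf.
have gE w : (g (f w))%:E = (\sum_i (g i)%:E * (\1_[set w | f w = i] w)%:E)%E.
  rewrite (bigD1 (f w))//= indicE mem_set// mule1 big1 ?adde0// => i /eqP fwi.
  by rewrite indicE memNset ?mule0//= => /esym.
have mind i : measurable_fun [set: T]
    (fun w => (\1_[set w | f w = i] w)%:E : \bar R).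
  by apply/measurable_EFinP; exact: measurable_indic.
under eq_integral do rewrite gE.
rewrite ge0_integral_sum//.
- apply: eq_bigr => i _; rewrite ge0_integralZl//.
  + by rewrite integral_indic// setIT.
  + by rewrite lee_fin.
- by move=> i; apply: measurable_funeM.
- by move=> i w _; rewrite mule_ge0// lee_fin.
Qed.

Lemma measurable_finite_valued (g : I -> R) :
  (forall i, measurable [set w | f w = i]) ->
  measurable_fun [set: T] (fun w => (g (f w))%:E : \bar R).
Proof.
move=> mf _ Y mY; rewrite setTI; apply: measurable_fibers => i.
rewrite [X in measurable X](_ : _ =
  if `[< Y (g i)%:E >] then [set w | f w = i] else set0); last first.
  case: asboolP => Yi; apply/seteqP; split => [w /= [Yw fw]|w //= fw] //.
  - by split => //; rewrite fw.
  - by apply: Yi; rewrite -fw.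
by case: asboolP.
Qed.
End FiniteValued.

(** * One-dimensional marginals of the law of a policy *)

Section Law.
Context {R : realType} (S : ssp R).
Implicit Types (pi : nat -> node S -> act S) (x y z : node S).

(** The expected value of [g] at time [n + m] given that [x] is occupied at
    time [n].  The recursion conditions on the first transition: this backward
    form is the one that the Bellman operator matches. *)
Fixpoint expect pi (n : nat) x (g : node S -> R) (m : nat) : R :=
  if m is m'.+1 then \sum_z trans x (pi n x) z * expect pi n.+1 z g m' else g x.

Lemma measurable_coordinate k x :
  measurable ([set w | w k = x] : set (trajectory_space S)).
Proof. by apply: sub_sigma_algebra; exists k, x. Qed.

Definition cylinder (n : nat) (w : trajectory S) : set (trajectory_space S) :=
  [set y | forall k, (k <= n)%N -> y k = w k].

(** A finite path is represented by any infinite trajectory that starts with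
    it, as in [is_law]; only the values up to time [n + 1] matter here. *)
Definition extend (n : nat) (w : trajectory S) z : trajectory S :=
  fun k => if k == n.+1 then z else w k.

Lemma cylinder_split n w z :
  cylinder n w `&` [set y | y n.+1 = z] = cylinder n.+1 (extend n w z).
Proof.
apply/seteqP; split => y /=.
  move=> [yw yz] k; rewrite leq_eqVlt /extend => /predU1P[->|kn].
    by rewrite eqxx.
  by rewrite ltn_eqF// yw.
move=> yw; split; last by rewrite yw// /extend eqxx.
by move=> k kn; rewrite yw ?(leqW kn)// /extend ltn_eqF.
Qed.

Lemma cylinder_end n w y : cylinder n w `&` [set v | v n = y] =
  if w n == y then cylinder n w else set0.
Proof.
case: eqP => [<-|wy]; apply/seteqP; split => v //=.
- by case.
- by move=> vw; split => //; rewrite vw.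
- by move=> [vw vy]; apply: wy; rewrite -vw.
Qed.

Lemma measurable_cylinder n w : measurable (cylinder n w).
Proof.
have -> : cylinder n w =
    \bigcap_(k in [set k | (k <= n)%N]) [set y | y k = w k].
  by [].
apply: bigcap_measurable => [|k _]; first by exists 0%N.
exact: measurable_coordinate.
Qed.

(** The Markov property, by induction on [m]: split the event according to the
    state at time [n + 1]; each part is a longer cylinder. *)
Lemma is_law_cylinder pi x P n m w y : is_law pi x P ->
  P (cylinder n w `&` [set v | v (n + m)%N = y]) =
  (P (cylinder n w) * (expect pi n (w n) (fun z => (z == y)%:R) m)%:E)%E.
Proof.
move=> lawP; elim: m n w => [|m IHm] n w /=.
  rewrite addn0 cylinder_end; case: eqP => _; first by rewrite mule1.
  by rewrite mule0 measure0.
rewrite (@measure_fibers _ _ _ _ P (fun v : trajectory_space S => v n.+1));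
  last first.
  move=> z; rewrite setIAC cylinder_split; apply: measurableI.
    exact: measurable_cylinder.
  exact: measurable_coordinate.
rewrite -sumEFin; have Pfin : P (cylinder n w) \is a fin_num.
  by apply: fin_num_measure; exact: measurable_cylinder.
rewrite -(fineK Pfin) sumEFin -EFinM mulr_sumr -sumEFin; apply: eq_bigr => z _.
rewrite setIAC cylinder_split -addSnnS; apply: etrans (IHm _ _) _.
have Pcyl k v : P (cylinder k v) = ((v 0%N == x)%:R *
   \prod_(k0 < k) trans (v k0) (pi k0 (v k0)) (v k0.+1))%:E := lawP k v.
rewrite !Pcyl /= -EFinM; congr EFin.
have ext_n k : (k <= n)%N -> extend n w z k = w k.
  by move=> kn; rewrite /extend ltn_eqF.
have ext_nS : extend n w z n.+1 = z by rewrite /extend eqxx.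
rewrite big_ord_recr/= ext_nS !ext_n// !mulrA; congr (_ * _ * _ * _).
by apply: eq_bigr => k _; rewrite !ext_n// ltnW.
Qed.

Lemma expectE pi n x g m :
  expect pi n x g m = \sum_y expect pi n x (fun z => (z == y)%:R) m * g y.
Proof.
elim: m n x => [|m IHm] n x /=.
  rewrite (bigD1 x)//= eqxx mul1r big1 ?addr0// => y.
  by rewrite eq_sym => /negPf ->; rewrite mul0r.
under eq_bigr do rewrite IHm mulr_sumr.
rewrite exchange_big/=; apply: eq_bigr => y _; rewrite mulr_suml.
by apply: eq_bigr => z _; rewrite mulrA.
Qed.

Lemma is_law_marginal pi x P m y : is_law pi x P ->
  P [set v | v m = y] = (expect pi 0 x (fun z => (z == y)%:R) m)%:E.
Proof.
move=> lawP.
rewrite (@measure_fibers _ _ _ _ P (fun v : trajectory_space S => v 0%N));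
  last first.
  by move=> z; apply: measurableI; exact: measurable_coordinate.
have cyl0 z : cylinder 0 (fun=> z) = [set v | v 0%N = z].
  apply/seteqP; split => v /=; first by apply.
  by move=> vz k; rewrite leqn0 => /eqP ->.
have term z : P ([set v | v m = y] `&` [set v | v 0%N = z]) =
    ((z == x)%:R * expect pi 0 z (fun z => (z == y)%:R) m)%:E.
  rewrite setIC -cyl0 -[in X in X = _](add0n m).
  apply: etrans (is_law_cylinder 0 m (fun=> z) y lawP) _.
  by rewrite (lawP 0%N (fun=> z)) big_ord0 mulr1 -EFinM.
rewrite (eq_bigr _ (fun z _ => term z)) (bigD1 x)//= eqxx mul1r.
by rewrite big1 ?adde0// => z /negPf ->; rewrite mul0r.
Qed.

Lemma integral_coordinate pi x P m g : is_law pi x P -> (forall y, 0 <= g y) ->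
  (\int[P]_v (g (v m))%:E)%E = (expect pi 0 x g m)%:E.
Proof.
move=> lawP g0.
rewrite (@ge0_integral_finite_valued _ _ _ _ P
  (fun v : trajectory_space S => v m))//; last first.
  by move=> y; exact: measurable_coordinate.
rewrite expectE -sumEFin; apply: eq_bigr => y _.
by rewrite EFinM muleC; congr (_ * _)%E; exact: is_law_marginal.
Qed.

End Law.

(** * Existence of the law of a policy *)

Section Slots.
Context {R : realType} {T : finType} (p : T -> R).
Hypotheses (p_ge0 : forall z, 0 <= p z) (p_sum1 : \sum_z p z = 1).

(** The consecutive intervals [slot z] of lengths [p z], in the order of the
    enumeration of [T], tile [0, 1[: a uniform number falls into [slot z] with
    probability [p z]. *)
Definition cumul (j : nat) : R :=
  \sum_(i < #|T| | (i < j)%N) p (enum_val i).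

Definition slot (z : T) (s : R) :=
  (cumul (enum_rank z) <= s) && (s < cumul (enum_rank z).+1).

Lemma cumulS (z : T) : cumul (enum_rank z).+1 = cumul (enum_rank z) + p z.
Proof.
rewrite /cumul (bigD1 (enum_rank z))//= enum_rankK addrC; congr (_ + _).
by apply: eq_bigl => i; rewrite -val_eqE/= ltnS ltn_neqAle andbC.
Qed.

Lemma cumul_le i j : (i <= j)%N -> cumul i <= cumul j.
Proof.
move=> ij; rewrite /cumul [leRHS](bigID (fun k : 'I__ => (k < i)%N))/=.
rewrite [X in _ <= X + _](eq_bigl (fun k : 'I_#|T| => (k < i)%N)).
  by rewrite lerDl sumr_ge0.
by move=> k; apply: andb_idl => ki; exact: leq_trans ij.
Qed.

Lemma cumul0 : cumul 0 = 0.
Proof. by rewrite /cumul big_pred0. Qed.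

Lemma cumul_card : cumul #|T| = 1.
Proof.
rewrite -p_sum1 /cumul (reindex (@enum_rank T))/=; last first.
  by exists (@enum_val T _) => z _; rewrite ?enum_rankK ?enum_valK.
by apply: eq_big => [z|z _]; rewrite ?ltn_ord ?enum_rankK.
Qed.

Lemma slot_exists s : 0 <= s < 1 -> exists z, slot z s.
Proof.
move=> /andP[s0 s1].
have ex : exists j, s < cumul j by exists #|T|; rewrite cumul_card.
case: (ex_minnP ex) => -[|j] sj minj.
  by move: sj; rewrite cumul0 ltNge s0.
have jT : (j < #|T|)%N by apply: minj; rewrite cumul_card.
exists (enum_val (Ordinal jT)); rewrite /slot enum_valK/= sj andbT leNgt.
by apply/negP => /minj; rewrite ltnn.
Qed.

Lemma slot_uniq s (z z' : T) : slot z s -> slot z' s -> z = z'.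
Proof.
move=> /andP[zs sz] /andP[z's sz'].
apply/enum_rank_inj/val_inj/eqP; rewrite eqn_leq; apply/andP; split.
  rewrite -ltnS ltnNge; apply/negP => /cumul_le le.
  by move: (lt_le_trans sz' (le_trans le zs)); rewrite ltxx.
rewrite -ltnS ltnNge; apply/negP => /cumul_le le.
by move: (lt_le_trans sz (le_trans le z's)); rewrite ltxx.
Qed.
End Slots.

Section UnitLebesgue.
Variable R : realType.

Definition unit_lebesgue : set (measurableTypeR R) -> \bar R :=
  mrestr lebesgue_measure (measurable_itv `[0, 1[).

HB.instance Definition _ := Measure.on unit_lebesgue.

Let unit_lebesgue_setT : unit_lebesgue setT = 1%E.
Proof.
by rewrite /unit_lebesgue /mrestr setTI lebesgue_measure_itv/= lte01 sube0.
Qed.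

HB.instance Definition _ :=
  Measure_isProbability.Build _ _ _ unit_lebesgue unit_lebesgue_setT.
End UnitLebesgue.

Section Coding.
Context {R : realType} (S : ssp R) (pi : nat -> node S -> act S) (x : node S).
Hypothesis pi_policy : policy pi.
Implicit Types (w : trajectory S) (u : R).

Let tr (n : nat) (y : node S) := trans y (pi n y).

Let tr_ge0 n y z : 0 <= tr n y z.
Proof. by apply: trans_ge0; exact: pi_policy. Qed.

Let tr_sum1 n y : \sum_z tr n y z = 1.
Proof. by apply: trans_sum1; exact: pi_policy. Qed.

(** A number [u] of [0, 1[ is decoded into a trajectory.  The state reached at
    time [n] is kept together with the left end [l] and the length [d] of the
    interval of all numbers with the same first [n] transitions.  That interval
    is cut proportionally to the transition probabilities, and the next state
    is read from the piece that contains [u].  The default value of [odflt] is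
    only reached for [u] outside [0, 1[. *)
Fixpoint code (u : R) (n : nat) : node S * (R * R) :=
  if n is m.+1 then
    let: (y, (l, d)) := code u m in
    let z := odflt (target S) [pick z | slot (tr m y) z ((u - l) / d)] in
    (z, (l + d * cumul (tr m y) (enum_rank z), d * tr m y z))
  else (x, (0, 1)).

(** The numbers whose first [n] transitions are those of [w] form the interval
    from [left_end w n] of length [len w n], the probability of that path. *)
Fixpoint left_end (w : trajectory S) (n : nat) : R :=
  if n is m.+1 then left_end w m +
    (\prod_(k < m) tr k (w k) (w k.+1)) *
      cumul (tr m (w m)) (enum_rank (w m.+1))
  else 0.

Let len (w : trajectory S) n := \prod_(k < n) tr k (w k) (w k.+1).

Let lenS w n : len w n.+1 = len w n * tr n (w n) (w n.+1).
Proof. by rewrite /len big_ord_recr. Qed.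

Let len_ge0 w n : 0 <= len w n.
Proof. by apply: prodr_ge0 => k _; exact: tr_ge0. Qed.

Let code_interval u w n : (forall k, (k <= n)%N -> (code u k).1 = w k) ->
  code u n = (w n, (left_end w n, len w n)).
Proof.
elim: n => [/(_ 0%N isT)/= <-|n IHn agree]; first by rewrite /len big_ord0.
have := agree n.+1 (leqnn _).
rewrite /= (IHn (fun k kn => agree k (leqW kn)))/= => ->.
by rewrite lenS.
Qed.

Let right_le w n : left_end w n.+1 + len w n.+1 <= left_end w n + len w n.
Proof.
rewrite lenS /= -addrA lerD2l -/(len w n) -mulrDr -cumulS ler_piMr ?len_ge0//.
rewrite -(cumul_card (tr_sum1 n (w n))).
by apply: cumul_le => //; exact: ltn_ord.
Qed.

Let left_le w n : left_end w n <= left_end w n.+1.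
Proof.
rewrite /= lerDl mulr_ge0// ?len_ge0// -(cumul0 (tr n (w n))).
exact: cumul_le.
Qed.

Let code_agreeP u w n : 0 <= u < 1 ->
  (forall k, (k <= n)%N -> (code u k).1 = w k) <->
  w 0%N = x /\ left_end w n <= u < left_end w n + len w n.
Proof.
move=> u01; elim: n => [|n IHn].
  rewrite /len big_ord0 add0r; split=> [/(_ 0%N isT)//|[wx _] k].
  by rewrite leqn0 => /eqP ->.
have slotE y (d := len w n) (l := left_end w n) : 0 < d ->
    slot (tr n (w n)) y ((u - l) / d) =
    (l + d * cumul (tr n (w n)) (enum_rank y) <= u <
     l + d * cumul (tr n (w n)) (enum_rank y) + d * tr n (w n) y).
  move=> d0; rewrite /slot ler_pdivlMr// ltr_pdivrMr// cumulS.
  by rewrite lerBrDl ltrBlDl ![_ * d]mulrC mulrDr addrA.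
split=> [agree|[wx /andP[lu ur]]].
  have agreen k (kn : (k <= n)%N) := agree k (leqW kn).
  have [wx lur] := IHn.1 agreen; split=> //.
  have d0 : 0 < len w n.
    case/andP: lur => lu ur; rewrite -(ltrD2l (left_end w n)) addr0.
    exact: le_lt_trans ur.
  have := agree n.+1 (leqnn _); rewrite /= (code_interval agreen).
  case: pickP => [z|/= none].
    by rewrite slotE// lenS => + /= <-.
  have [|z] := @slot_exists _ _ _ (tr_sum1 n (w n))
    ((u - left_end w n) / len w n); last by rewrite none.
  case/andP: lur => lu ur.
  by rewrite ler_pdivlMr// ltr_pdivrMr// mul0r mul1r subr_ge0 lu ltrBlDl.
have agree : forall k, (k <= n)%N -> (code u k).1 = w k.
  apply/IHn; split=> //; rewrite (le_trans (left_le w n) lu)/=.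
  by rewrite (lt_le_trans ur)// right_le.
move=> k; rewrite leq_eqVlt => /predU1P[->|]; last exact: agree.
have d0 : 0 < len w n.
  rewrite lt_neqAle len_ge0 andbT eq_sym; apply/eqP => d0.
  by move: (le_lt_trans lu ur); rewrite lenS d0 mul0r addr0 ltxx.
rewrite /= (code_interval agree); case: pickP => [z /= zs|/= /(_ (w n.+1))].
  by apply: slot_uniq zs _ => //; rewrite slotE// -lenS lu ur.
by rewrite slotE// -lenS lu ur.
Qed.

Definition coded_trajectory (u : R) : trajectory_space S :=
  if 0 <= u < 1 then fun k => (code u k).1 else fun=> target S.

Let cylinderE w n : coded_trajectory @^-1` (cylinder n w) `&` `[0, 1[ =
  if w 0%N == x then `[left_end w n, left_end w n + len w n[%classic else set0.
Proof.
have left_ge0 m : 0 <= left_end w m.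
  by elim: m => // m /le_trans; apply; exact: left_le.
have right_le1 m : left_end w m + len w m <= 1.
  elim: m => [|m]; first by rewrite /len big_ord0 add0r.
  by apply: le_trans; exact: right_le.
apply/seteqP; split=> [u /= [+ u01]|u].
  move: (u01); rewrite in_itv/= /coded_trajectory => u01' .
  rewrite u01' => /(code_agreeP _ _ u01')[-> lur].
  by rewrite eqxx /= in_itv.
case: eqP => // wx; rewrite /= in_itv/= => lur.
have u01 : 0 <= u < 1.
  case/andP: lur => lu ur.
  by rewrite (le_trans (left_ge0 n) lu) (lt_le_trans ur (right_le1 n)).
by split=> //; rewrite /coded_trajectory u01; apply/code_agreeP.
Qed.

Let measurable_coded_trajectory :
  measurable_fun [set: measurableTypeR R] coded_trajectory.
Proof.
(* Preimages of cylinders are intervals; a preimage of a coordinate event is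
   cut into these by the same induction as in [is_law_cylinder]. *)
have mcyl m : forall n w y, measurable (coded_trajectory @^-1`
    (cylinder n w `&` [set v | v (n + m)%N = y]) `&` `[0, 1[
    : set (measurableTypeR R)).
  elim: m => [|m IHm] n w y.
    rewrite addn0 cylinder_end; case: eqP => _; last first.
      by rewrite preimage_set0 set0I.
    by rewrite cylinderE; case: eqP => _ //; exact: measurable_itv.
  apply: (measurable_fibers (f := fun u => coded_trajectory u n.+1)) => z.
  rewrite [X in measurable X](_ : _ = coded_trajectory @^-1`
    (cylinder n.+1 (extend n w z) `&` [set v | v (n.+1 + m)%N = y])
      `&` `[0, 1[).
    exact: IHm.
  rewrite -cylinder_split addSnnS; apply/seteqP.
  by split=> u /=; tauto.
refine (@measurability _ _ (measurableTypeR R) (trajectory_space S) _ _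
  (coordinate_events (S := S)) erefl _).
move=> _ [_ [k [y ->]] <-]; rewrite setTI.
rewrite -(setIT (_ @^-1` _)) -(setvU (`[0, 1[%classic : set R)) setIUr.
apply: measurableU.
  rewrite [X in measurable X](_ : _ =
    if y == target S then ~` `[0, 1[%classic else set0).
    by case: eqP => // _; apply: measurableC; exact: measurable_itv.
  apply/seteqP; split=> u /=; rewrite /coded_trajectory in_itv/=.
    move=> [+ /negP/negPf u01]; rewrite u01 => <-.
    by rewrite eqxx /= in_itv/= u01.
  case: eqP => //= ->; rewrite in_itv/= => /negP/negPf u01.
  by rewrite u01; split.
apply: (measurable_fibers (f := fun u => coded_trajectory u 0%N)) => z.
have := mcyl k 0%N (fun=> z) y; congr (measurable _).
apply/seteqP; split=> u /=.
  by move=> [[uz uy] u01]; split => //; exact: uz.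
move=> [[uy u01] uz]; split => //; split => //.
by move=> j; rewrite leqn0 => /eqP ->.
Qed.

(** The image under the decoding of the uniform measure on [0, 1[ gives each
    cylinder the length of its interval, which is the prescribed product. *)
Lemma is_law_exists : exists P, is_law pi x P.
Proof.
pose X := @mfun_Sub _ _ (measurableTypeR R) (trajectory_space S) _
  (mem_set measurable_coded_trajectory).
exists (distribution (@unit_lebesgue R) X) => n w.
rewrite /distribution/= /pushforward /unit_lebesgue /mrestr.
rewrite [X in lebesgue_measure X](_ : _ =
  coded_trajectory @^-1` (cylinder n w) `&` `[0, 1[)//.
rewrite cylinderE; case: eqP => _; last by rewrite mul0r measure0.
rewrite mul1r lebesgue_measure_itv/= lte_fin.
case: ltP => [_|]; first by rewrite -EFinB addrAC subrr add0r.
rewrite -[leRHS]addr0 lerD2l => len_le0; congr EFin; apply/eqP.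
by rewrite eq_le len_ge0 len_le0.
Qed.
End Coding.

Section ExpectedCost.
Context {R : realType} (S : ssp R).
Implicit Types (pi : nat -> node S -> act S) (x y z : node S).

Lemma law_is_law pi x : policy pi -> is_law pi x (law pi x).
Proof.
move=> /is_law_exists-/(_ x) [P lawP].
exact: (xgetPex _ (ex_intro _ P lawP)).
Qed.

Lemma expected_costE pi x : policy pi ->
  (forall y a, actions y a -> 0 <= cost y a) ->
  expected_cost x pi =
  (\sum_(k <oo) (expect pi 0 x (fun y => cost y (pi k y)) k)%:E)%E.
Proof.
move=> pi_pol cost0; have lawP := law_is_law x pi_pol.
have cost_pi k y : 0 <= cost y (pi k y) by apply: cost0; exact: pi_pol.
rewrite /expected_cost (@integral_nneseries _ _ _ (law pi x) _ _
  (fun k (w : trajectory_space S) => (cost (w k) (pi k (w k)))%:E))//.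
- by apply: eq_eseriesr => k _; exact: (integral_coordinate k lawP (cost_pi k)).
- move=> k; apply: (measurable_finite_valued
    (f := fun w : trajectory_space S => w k) (fun y => cost y (pi k y))) => y.
  exact: measurable_coordinate.
- by move=> k w _; rewrite lee_fin.
Qed.
End ExpectedCost.

(** * Semicontinuous functions on a compact set *)

Section Compactness.
Context {T : topologicalType} {R : realType} (A : set T).

Definition relatively_closed (F : set T) :=
  forall a, A a -> ~ F a -> within A (nbhs a) (~` F).

Definition lsc_on (f : T -> R) :=
  forall a c, A a -> c < f a -> within A (nbhs a) [set b | c < f b].

(** The finite intersection property, in the form of directed families: the
    sets generate a filter, and a cluster point of it lies in all of them. *)
Lemma compact_directed (I : Type) (D : set I) (F : I -> set T) :
  compact A -> D !=set0 ->
  (forall i j, D i -> D j -> exists2 k, D k & A `&` F k `<=` F i `&` F j) ->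
  (forall i, D i -> A `&` F i !=set0) ->
  (forall i, D i -> relatively_closed (F i)) ->
  exists2 a, A a & forall i, D i -> F i a.
Proof.
move=> cA [i0 Di0] dirF F0 clF.
pose G := filter_from D (fun i => A `&` F i).
have GF : ProperFilter G.
  apply: filter_from_proper; last by move=> i /F0.
  apply: filter_from_filter; first by exists i0.
  move=> i j Di Dj; have [k Dk kij] := dirF i j Di Dj.
  by exists k => // a AFka; case: (kij _ AFka); case: AFka.
have GA : G A by exists i0 => // a [].
have [a [Aa aG]] := cA G GF GA.
exists a => // i Di; apply: contrapT => nFia.
have [|b [[Ab Fib] /(_ Ab)]] := aG (A `&` F i) _ _ (clF i Di a Aa nFia).
  by exists i.
exact.
Qed.

Lemma relatively_closedT : relatively_closed setT.
Proof. by move=> a _; case. Qed.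

Lemma relatively_closedI F G :
  relatively_closed F -> relatively_closed G -> relatively_closed (F `&` G).
Proof.
move=> clF clG a Aa /not_andP[nF|nG].
  by apply: filterS (clF a Aa nF) => b nFb [].
by apply: filterS (clG a Aa nG) => b nGb [].
Qed.

Lemma lsc_sublevel f c : lsc_on f -> relatively_closed [set a | f a <= c].
Proof.
move=> lf a Aa /negP; rewrite -ltNge => /(lf a c Aa).
by apply: filterS => b /= cb; apply/negP; rewrite -ltNge.
Qed.

(** The minimizers are the common points of the sublevel sets at attained
    values, a totally ordered family. *)
Lemma lsc_attains_min f F : compact A -> A `&` F !=set0 ->
  relatively_closed F -> lsc_on f ->
  exists a, [/\ A a, F a & forall b, A b -> F b -> f a <= f b].
Proof.
move=> cA AF0 clF lf.
have [|||a Aa amin] := @compact_directed _ (A `&` F)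
  (fun b => F `&` [set a | f a <= f b]) cA AF0.
- move=> b c AFb AFc; have [fbc|/ltW fcb] := leP (f b) (f c).
    exists b => // a [_ [Fa /= fab]]; split; split => //.
    exact: le_trans fbc.
  exists c => // a [_ [Fa /= fab]]; split; split => //.
  exact: le_trans fcb.
- by move=> b [Ab Fb]; exists b; split => //; split => /=.
- move=> b _; apply: relatively_closedI => //; exact: lsc_sublevel.
have [b [Ab Fb]] := AF0.
exists a; split => //; first by case: (amin b (conj Ab Fb)).
by move=> c Ac Fc; case: (amin c (conj Ac Fc)).
Qed.

Lemma lscD f g : lsc_on f -> lsc_on g -> lsc_on (fun a => f a + g a).
Proof.
move=> lf lg a c Aa cfg; pose e := (f a + g a - c) / 2.
have e0 : 0 < e by rewrite divr_gt0// subr_gt0.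
have /(lf a _ Aa) nf : f a - e < f a by rewrite ltrBlDr ltrDl.
have /(lg a _ Aa) ng : g a - e < g a by rewrite ltrBlDr ltrDl.
have ->: c = (f a - e) + (g a - e) by rewrite /e; field.
by apply: filterS2 nf ng => b /= fb gb; exact: ltrD.
Qed.

Lemma continuous_lsc f : {within A, continuous f} -> lsc_on f.
Proof.
move=> /subspace_continuousP cf a c Aa cfa.
exact: (cf a Aa) _ (lt_nbhsr _).
Qed.

Lemma lsc_sum (I : Type) (r : seq I) (P : pred I) (f : I -> T -> R) :
  (forall i, lsc_on (f i)) -> lsc_on (fun a => \sum_(i <- r | P i) f i a).
Proof.
move=> lf; elim: r => [|i r IHr].
  under eq_fun do rewrite big_nil.
  by move=> a c Aa c0; exact: nearW.
under eq_fun do rewrite big_cons.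
by case: (P i) => //; exact: lscD.
Qed.

End Compactness.

(** * Finite-horizon costs *)

Section Bellman.
Context {R : realType} (S : ssp R).
Hypotheses (cost_lsc : lsc_cost S) (trans_cont : continuous_trans S).
Hypotheses (cost_pos : positive_cost S).
Implicit Types (V W : node S -> R) (x y z : node S) (a : act S) (n m : nat).

Definition q_value V x a := cost x a + \sum_y trans x a y * V y.

Lemma lsc_on_cost x : lsc_on (actions x) (cost x).
Proof.
move=> a c Aa ca; have [|W] := @cost_lsc x a c; first by rewrite lte_fin.
rewrite {1}/nbhs/= -nbhs_subspace_in// => nW Wc.
by apply: filterS nW => b /Wc; rewrite lte_fin.
Qed.

Lemma lsc_on_trans x y (k : R) : lsc_on (actions x) (fun a => trans x a y * k).
Proof.
apply: continuous_lsc => a.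
by apply: continuousM; [exact: trans_cont|exact: cst_continuous].
Qed.

Lemma lsc_q_value V x : lsc_on (actions x) (q_value V x).
Proof.
apply: lscD; first exact: lsc_on_cost.
by apply: lsc_sum => y; exact: lsc_on_trans.
Qed.

Lemma trans_eq0 x a y z : actions x a -> trans x a y = 1 -> z != y ->
  trans x a z = 0.
Proof.
move=> Aa xy1 zy; have := trans_sum1 Aa; rewrite (bigD1 y)//= xy1.
move/(canRL (addKr _)); rewrite addNr => /eqP.
rewrite psumr_eq0; last by move=> ? _; exact: trans_ge0.
by move=> /allP/(_ z (mem_index_enum _)); rewrite zy => /eqP.
Qed.

Lemma q_value_det V x a y : actions x a -> trans x a y = 1 ->
  q_value V x a = cost x a + V y.
Proof.
move=> Aa xy1; rewrite /q_value (bigD1 y)//= xy1 mul1r big1 ?addr0// => z zy.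
by rewrite (trans_eq0 Aa xy1 zy) mul0r.
Qed.

(** At the target every action is a fixed point of [q_value], so that the
    Bellman inequalities need no special case there. *)
Lemma q_value_target V a : actions (target S) a ->
  q_value V (target S) a = V (target S).
Proof.
by move=> Aa; rewrite (q_value_det _ Aa (trans_target Aa)) cost_target// add0r.
Qed.

Lemma le_q_value V W x a : actions x a -> (forall y, V y <= W y) ->
  q_value V x a <= q_value W x a.
Proof.
move=> Aa VW; rewrite lerD2l; apply: ler_sum => y _.
by rewrite ler_wpM2l// trans_ge0.
Qed.

Lemma cost_ge0 x a : actions x a -> 0 <= cost x a.
Proof.
have [->|xt] := eqVneq x (target S); first by move=> /cost_target ->.
by move=> Aa; apply/ltW/cost_pos.
Qed.

Section Policies.
Variables (pi : nat -> node S -> act S).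
Hypothesis pi_policy : policy pi.

Lemma expect_ge0 n x g m : (forall y, 0 <= g y) -> 0 <= expect pi n x g m.
Proof.
move=> g0; elim: m n x => //= m IHm n x.
by apply: sumr_ge0 => y _; rewrite mulr_ge0// trans_ge0//; exact: pi_policy.
Qed.

Definition partial_cost n x m : R :=
  \sum_(k < m) expect pi n x (fun y => cost y (pi (n + k)%N y)) k.

(** Conditioning on the first transition: the policy is kept and the starting
    time advances. *)
Lemma partial_costS n x m :
  partial_cost n x m.+1 = q_value (fun y => partial_cost n.+1 y m) x (pi n x).
Proof.
rewrite /partial_cost /q_value big_ord_recl/= addn0; congr (_ + _).
under [RHS]eq_bigr do rewrite mulr_sumr.
rewrite exchange_big/=; apply: eq_bigr => k _; apply: eq_bigr => y _.
by rewrite /bump/= add1n addnS.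
Qed.

Lemma partial_cost_ge0 n x m : 0 <= partial_cost n x m.
Proof.
apply: sumr_ge0 => k _; apply: expect_ge0 => y.
by apply: cost_ge0; exact: pi_policy.
Qed.

Lemma partial_cost_le x m :
  ((partial_cost 0 x m)%:E <= expected_cost x pi)%E.
Proof.
rewrite (expected_costE x pi_policy cost_ge0) /partial_cost -sumEFin.
rewrite -(big_mkord xpredT
  (fun k => (expect pi 0 x (fun y => cost y (pi k y)) k)%:E)).
apply: nneseries_lim_ge => k _ _; rewrite lee_fin expect_ge0// => y.
by apply: cost_ge0; exact: pi_policy.
Qed.

Lemma expected_cost_le x (c : \bar R) :
  (forall m, ((partial_cost 0 x m)%:E <= c)%E) -> (expected_cost x pi <= c)%E.
Proof.
move=> le_c; rewrite (expected_costE x pi_policy cost_ge0).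
apply: lime_le.
  apply: is_cvg_nneseries => k _ _; rewrite lee_fin expect_ge0// => y.
  by apply: cost_ge0; exact: pi_policy.
by apply: nearW => m; rewrite big_mkord sumEFin; exact: le_c.
Qed.

Definition edge : rel (node S) :=
  fun x y => `[< exists2 a, actions x a & 0 < trans x a y >].

Lemma expect_neq0_connect n x y m :
  expect pi n x (fun z => (z == y)%:R) m != 0 -> connect edge x y.
Proof.
elim: m n x => [|m IHm] n x /=.
  by have [->|_] := eqVneq x y; rewrite ?eqxx.
apply: contraNT => nxy; apply/eqP/big1 => z _.
have [->|xz] := eqVneq (trans x (pi n x) z) 0; first by rewrite mul0r.
have [->|zy] := eqVneq (expect pi n.+1 z (fun z => (z == y)%:R) m) 0.
  by rewrite mulr0.
case/negP: nxy; apply: connect_trans (IHm _ _ zy).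
apply/connect1/asboolP; exists (pi n x); first exact: pi_policy.
by rewrite lt_neqAle eq_sym xz trans_ge0//; exact: pi_policy.
Qed.

(** If [y] is not reachable in the graph of possible transitions, every event
    [w k = y] is null, and so is their countable union. *)
Lemma hit_connect x y : law pi x [set w | exists k, w k = y] = 1%E ->
  connect edge x y.
Proof.
move=> hit1; apply: contrapT => nxy.
have lawP := law_is_law x pi_policy.
have null k : law pi x [set w : trajectory_space S | w k = y] = 0%E.
  rewrite (is_law_marginal k y lawP); congr EFin.
  by apply/eqP; apply: contraT => /expect_neq0_connect.
have hitE : [set w : trajectory_space S | exists k, w k = y] =
    \bigcup_k [set w : trajectory_space S | w k = y].
  by apply/seteqP; split=> [w [k]|w [k _]] wk; exists k.
have mhit : measurable [set w : trajectory_space S | exists k, w k = y].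
  by rewrite hitE; apply: bigcupT_measurable => k; exact: measurable_coordinate.
have : (law pi x [set w : trajectory_space S | exists k, w k = y] <=
    \sum_(k <oo) law pi x [set w : trajectory_space S | w k = y])%E.
  apply: measure_sigma_subadditive => //; last by rewrite hitE.
  by move=> k; exact: measurable_coordinate.
by rewrite eseries0 => [|k _ _]; [rewrite hit1 lee_fin ler10|exact: null].
Qed.

End Policies.
End Bellman.

(** * Value iteration *)

Section ValueIteration.
Context {R : realType} (S : ssp R).
Hypotheses (opport : opportunistic S).
Hypotheses (act_compact : compact_actions S) (cost_lsc : lsc_cost S).
Hypotheses (trans_cont : continuous_trans S).
Hypotheses (proper : proper_policy_exists S) (cost_pos : positive_cost S).
Implicit Types (V W : node S -> R) (x y z : node S) (a : act S) (n m : nat).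

Let actions_neq0 x : actions x !=set0.
Proof.
by have [pi pi_policy _] := proper; exists (pi 0%N x); exact: pi_policy.
Qed.

Definition bellman V x : R :=
  if x == target S then 0 else inf [set q_value V x a | a in actions x].

Lemma bellman_min V x : x != target S ->
  exists2 a, actions x a &
    bellman V x = q_value V x a /\
    forall b, actions x b -> q_value V x a <= q_value V x b.
Proof.
move=> xt.
have [|a [Aa _ amin]] := lsc_attains_min (F := setT) (act_compact (x := x)) _
  (@relatively_closedT _ _) (@lsc_q_value _ _ cost_lsc trans_cont V x).
  by rewrite setIT.
exists a => //; split; last by move=> b Ab; exact: amin.
rewrite /bellman (negPf xt); apply/eqP; rewrite eq_le; apply/andP; split.
  apply: ge_inf; last by exists a.
  by exists (q_value V x a) => _ [b Ab <-]; exact: amin.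
apply: lb_le_inf; first by exists (q_value V x a), a.
by move=> _ [b Ab <-]; exact: amin.
Qed.

Lemma bellman_le V x a : x != target S -> actions x a ->
  bellman V x <= q_value V x a.
Proof. by move=> /(bellman_min V)[b Ab [-> bmin]]; exact: bmin. Qed.

Lemma bellman_mono V W x : (forall y, V y <= W y) -> bellman V x <= bellman W x.
Proof.
move=> VW; have [->|xt] := eqVneq x (target S); first by rewrite /bellman eqxx.
have [a Aa [-> _]] := bellman_min W xt.
by apply: le_trans (bellman_le V xt Aa) _; exact: le_q_value.
Qed.

Definition iterate n : node S -> R := iter n bellman (fun=> 0).

Lemma iterate_target n : iterate n (target S) = 0.
Proof. by case: n => //= n; rewrite /bellman eqxx. Qed.

Lemma iterateS_le n x : iterate n x <= iterate n.+1 x.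
Proof.
elim: n x => [|n IHn] x; last exact: bellman_mono.
have [->|xt] := eqVneq x (target S); first by rewrite !iterate_target.
rewrite /=; have [a Aa [-> _]] := bellman_min (fun=> 0) xt.
by rewrite /q_value big1 ?addr0 ?cost_ge0// => y _; rewrite mulr0.
Qed.

Lemma iterate_le n m x : (n <= m)%N -> iterate n x <= iterate m x.
Proof.
move=> /subnK <-; elim: (m - n)%N => // k IHk.
by rewrite addSn; apply: le_trans IHk (iterateS_le _ _).
Qed.

Lemma iterate_partial_cost pi n m x : policy pi ->
  iterate m x <= partial_cost pi n x m.
Proof.
move=> pi_policy; elim: m n x => [|m IHm] n x.
  by rewrite /partial_cost big_ord0.
have [->|xt] := eqVneq x (target S).
  by rewrite iterate_target; exact: (partial_cost_ge0 cost_pos pi_policy).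
rewrite partial_costS; apply: le_trans (bellman_le _ xt (pi_policy n x)) _.
by apply: le_q_value => //; exact: pi_policy.
Qed.

(** This is where opportunism enters: an edge of the transition graph is also
    the move of a deterministic action, so a path to the target is a route
    that is followed with certainty, at a finite cost. *)
Lemma iterate_bounded x : exists B, forall n, iterate n x <= B.
Proof.
have [pi pi_policy hit] := proper.
have /connectP[p + tp] := hit_connect pi_policy (hit x).
elim: p x tp => [x /= <- _|y p IHp x /= tp].
  by exists 0 => n; rewrite iterate_target.
have [->|xt] := eqVneq x (target S).
  by exists 0 => n; rewrite iterate_target.
case/andP=> /asboolP[b Ab xy] /(IHp y tp)[B yB].
have [a Aa xy1] := opport Ab xy.
exists (cost x a + B) => n; apply: le_trans (iterateS_le n x) _.
apply: le_trans (bellman_le _ xt Aa) _.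
by rewrite (q_value_det _ Aa xy1) lerD2l.
Qed.

Definition limit_value x : R := sup (range (iterate^~ x)).

Let has_ub_iterate x : has_ubound (range (iterate^~ x)).
Proof.
by have [B xB] := iterate_bounded x; exists B => _ [n _ <-].
Qed.

Lemma iterate_le_limit n x : iterate n x <= limit_value x.
Proof. by apply: ub_le_sup => //; exists n. Qed.

Lemma limit_value_le c x : (forall n, iterate n x <= c) -> limit_value x <= c.
Proof.
move=> le_c; apply: ge_sup; first by exists (iterate 0 x), 0%N.
by move=> _ [n _ <-].
Qed.

Lemma limit_value_target : limit_value (target S) = 0.
Proof.
apply/eqP; rewrite eq_le limit_value_le => [/=|n];
  last by rewrite iterate_target.
by rewrite -{1}(iterate_target 0) iterate_le_limit.
Qed.

Lemma limit_value_ge0 x : 0 <= limit_value x.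
Proof. exact: (iterate_le_limit 0 x). Qed.

Lemma limit_value_le_q x a : x != target S -> actions x a ->
  limit_value x <= q_value limit_value x a.
Proof.
move=> xt Aa; apply: limit_value_le => n; apply: le_trans (iterateS_le n x) _.
apply: le_trans (bellman_le _ xt Aa) _; apply: le_q_value => // y.
exact: iterate_le_limit.
Qed.

(** [node S] is finite, so one iterate is within [e] of the limit at all nodes
    at once. *)
Lemma q_value_limit_le x a c : actions x a ->
  (forall n, q_value (iterate n) x a <= c) -> q_value limit_value x a <= c.
Proof.
move=> Aa le_c; apply/ler_addgt0Pr => e e0.
suff [n limn] : exists n, forall y, limit_value y <= iterate n y + e.
  apply: le_trans (_ : q_value (fun y => iterate n y + e) x a <= _).
    exact: le_q_value.
  rewrite /q_value; under eq_bigr do rewrite mulrDr.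
  rewrite big_split/= -mulr_suml trans_sum1// mul1r addrA lerD2r.
  exact: le_c.
have lim1 y : exists n, limit_value y <= iterate n y + e.
  have [|_ [n _ <-] /ltW] := @sup_adherent _ (range (iterate^~ y)) e e0.
    by split => //; exists (iterate 0 y), 0%N.
  by rewrite lerBlDr => ?; exists n.
have [f fP] := choice lim1.
exists (\max_y f y) => y; apply: le_trans (fP y) _.
by rewrite lerD2r iterate_le// leq_bigmax.
Qed.

(** The actions [a] with [q_value (iterate n) x a <= limit_value x] form a
    decreasing sequence of nonempty relatively closed sets if [x] is not the
    target; a common point of them is greedy for the limit. *)
Lemma limit_value_attained x : exists2 a, actions x a &
  q_value limit_value x a <= limit_value x.
Proof.
have [->|xt] := eqVneq x (target S).
  have [a Aa] := actions_neq0 (target S).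
  by exists a => //; rewrite q_value_target.
have [||||a Aa aP] := @compact_directed _ (actions x) _ [set: nat]
  (fun n => [set a | q_value (iterate n) x a <= limit_value x])
  (act_compact (x := x)).
- by exists 0%N.
- move=> n m _ _; exists (maxn n m) => //= a [Aa le_lim].
  by split; apply: le_trans le_lim; apply: le_q_value => // y;
    rewrite ?iterate_le ?leq_maxl ?leq_maxr.
- move=> n _; have [a Aa [+ _]] := bellman_min (iterate n) xt.
  move=> E; exists a; split => //=; rewrite -E; exact: (iterate_le_limit n.+1).
- by move=> n _; apply: lsc_sublevel; exact: lsc_q_value.
by exists a => //; apply: q_value_limit_le => // n; exact: aP.
Qed.

Lemma expected_cost_ge pi x : policy pi ->
  ((limit_value x)%:E <= expected_cost x pi)%E.
Proof.
move=> pi_policy.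
have le_iter n : ((iterate n x)%:E <= expected_cost x pi)%E.
  apply: le_trans (partial_cost_le cost_pos pi_policy x n).
  by rewrite lee_fin iterate_partial_cost.
case: (expected_cost x pi) le_iter => [r||] le_iter.
- by rewrite lee_fin; apply: limit_value_le => n; rewrite -lee_fin.
- exact: leey.
- by have := le_iter 0%N.
Qed.

(** A nonnegative terminal value can only increase a finite-horizon cost, hence
    no finite horizon of the greedy policy costs more than [limit_value]. *)
Lemma greedy_cost_le mu x : control mu ->
  (forall y, q_value limit_value y (mu y) <= limit_value y) ->
  (expected_cost x (fun=> mu) <= (limit_value x)%:E)%E.
Proof.
move=> mu_control greedy; apply: expected_cost_le => // m; rewrite lee_fin.
elim: m (0%N) x => [|m IHm] n x.
  by rewrite /partial_cost big_ord0 limit_value_ge0.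
rewrite partial_costS; apply: le_trans (greedy x).
by apply: le_q_value => //; exact: mu_control.
Qed.

Lemma greedy_optimal mu : control mu ->
  (forall y, q_value limit_value y (mu y) <= limit_value y) ->
  optimal_stationary mu.
Proof.
move=> mu_control greedy; split=> // x.
apply/eqP; rewrite eq_le; apply/andP; split.
  apply: le_ereal_inf_tmp => _ [pi pi_policy <-].
  apply: le_trans (greedy_cost_le x mu_control greedy) _.
  exact: expected_cost_ge.
by apply: ereal_inf_lbound; exists (fun=> mu).
Qed.

Lemma valueE x : value x = (limit_value x)%:E.
Proof.
have ex_greedy y : exists a,
    actions y a /\ q_value limit_value y a <= limit_value y.
  by have [a ? ?] := limit_value_attained y; exists a.
have [mu muP] := choice ex_greedy.
have mu_control : control mu by move=> y; case: (muP y).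
have greedy y : q_value limit_value y (mu y) <= limit_value y by case: (muP y).
have [_ <-] := greedy_optimal mu_control greedy.
apply/eqP; rewrite eq_le greedy_cost_le//=.
by apply: expected_cost_ge => _.
Qed.
End ValueIteration.

(** * Causality of an extreme optimal action *)

Section Causality.
Context {R : realType} (S : ssp R).
Hypotheses (act_compact : compact_actions S) (cost_lsc : lsc_cost S).
Hypotheses (trans_cont : continuous_trans S).
Hypotheses (cost_pos : positive_cost S).
Variables (U : node S -> R) (x : node S).
Hypotheses (xt : x != target S).
Hypotheses (U_le_q : forall a, actions x a -> U x <= q_value U x a).
Hypotheses (U_attained : exists2 a, actions x a & q_value U x a <= U x).
Implicit Types (y z : node S) (a : act S) (b : relaxed S) (A : {set node S}).

Lemma in_succs a y : (y \in succs x a) = (0 < trans x a y).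
Proof. by rewrite inE. Qed.

(** A single inequality on a continuous function of the action, so that the
    sublevel lemma makes this set relatively closed. *)
Definition supported_in A : set (act S) :=
  [set a | \sum_(y | y \notin A) trans x a y <= 0].

Lemma supported_inP A a : actions x a ->
  supported_in A a <-> succs x a \subset A.
Proof.
move=> Aa; have p0 y : 0 <= trans x a y by exact: trans_ge0.
split=> [sup|/fintype.subsetP sub].
  apply/fintype.subsetP => y; rewrite in_succs; apply: contraTT => yA.
  rewrite -leNgt; apply: le_trans sup; rewrite (bigD1 y)//= lerDl.
  by apply: sumr_ge0.
rewrite /supported_in/= big1// => y yA; apply/eqP; rewrite eq_le p0 andbT leNgt.
by rewrite -in_succs; apply: contra yA => /sub.
Qed.

Lemma supported_in_closed A : relatively_closed (actions x) (supported_in A).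
Proof.
apply: lsc_sublevel; apply: lsc_sum => y.
have := @lsc_on_trans _ _ trans_cont x y 1.
by under eq_fun do rewrite mulr1.
Qed.

Lemma relaxed_q b : rcost x b + \sum_y rtrans x b y * U y =
  \sum_r rweight r * q_value U x (@ract _ _ b r).
Proof.
rewrite /q_value; under [RHS]eq_bigr do rewrite mulrDr mulr_sumr.
rewrite big_split/=; congr (_ + _); rewrite exchange_big/=.
apply: eq_bigr => y _.
by rewrite /rtrans mulr_suml; apply: eq_bigr => r _; rewrite mulrA.
Qed.

Lemma relaxed_q_ge b (c : R) : relaxed_at x b ->
  (forall r, 0 < @rweight _ _ b r -> c <= q_value U x (ract r)) ->
  c <= rcost x b + \sum_y rtrans x b y * U y.
Proof.
move=> [_ w0 w1] c_le; rewrite relaxed_q -[leLHS]mul1r -w1 mulr_suml.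
apply: ler_sum => r _; have := w0 r; rewrite le_eqVlt => /predU1P[<-|wr0].
  by rewrite !mul0r.
by rewrite ler_wpM2l// c_le.
Qed.

Lemma relaxed_support b r y : relaxed_at x b -> 0 < @rweight _ _ b r ->
  0 < trans x (ract r) y -> 0 < rtrans x b y.
Proof.
move=> [Ab w0 _] wr0 py0; rewrite /rtrans (bigD1 r)//= ltr_pwDl ?mulr_gt0//.
by apply: sumr_ge0 => r' _; rewrite mulr_ge0// trans_ge0.
Qed.

Let optimal a := actions x a /\ q_value U x a <= U x.

Lemma minimal_support : exists2 A : {set node S},
  (exists2 a, optimal a & succs x a \subset A) &
  forall a, optimal a -> succs x a \subset A -> succs x a = A.
Proof.
have ex : exists n, `[< exists2 a, optimal a & #|succs x a| = n >].
  have [a Aa qa] := U_attained; exists #|succs x a|; apply/asboolP.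
  by exists a.
case: (ex_minnP ex) => n /asboolP[a opta an] nmin.
exists (succs x a); first by exists a.
move=> c optc ca; apply/eqP; rewrite finset.eqEcard ca an/=.
by apply: nmin; apply/asboolP; exists c.
Qed.

(** The squared Euclidean norm is strictly convex, so an action that maximizes
    it has an extreme point as its vector of transition probabilities. *)
Lemma extreme_action A : (exists2 a, optimal a & succs x a \subset A) ->
  exists a, [/\ optimal a, succs x a \subset A & forall c, optimal c ->
    succs x c \subset A ->
    \sum_y trans x c y * trans x c y <= \sum_y trans x a y * trans x a y].
Proof.
move=> [a0 [Aa0 qa0] a0A].
have lsq : lsc_on (actions x) (fun a => \sum_y - (trans x a y * trans x a y)).
  apply: lsc_sum => y; apply: continuous_lsc => a.
  by apply: cvgN; apply: cvgM; exact: trans_cont.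
have clF : relatively_closed (actions x)
    ([set a | q_value U x a <= U x] `&` supported_in A).
  apply: relatively_closedI; last exact: supported_in_closed.
  by apply: lsc_sublevel; exact: lsc_q_value.
have [|a [Aa [qa sa] amin]] := lsc_attains_min (act_compact (x := x)) _ clF lsq.
  by exists a0; split => //; split => //; apply/supported_inP.
exists a; split => //; first exact/supported_inP.
move=> c [Ac qc] /(supported_inP _ Ac) sc.
by have := amin c Ac (conj qc sc); rewrite !sumrN lerN2.
Qed.

(** Relaxed actions obey the Bellman inequality too, so none with the same
    transitions as an optimal action can be cheaper. *)
Lemma optimal_not_dominated a : optimal a -> ~ prob_dominated x a.
Proof.
move=> [Aa qa] [b [bx ba] cost_lt].
have := relaxed_q_ge bx (fun r _ => U_le_q (let: And3 Ab _ _ := bx in Ab r)).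
rewrite leNgt => /negP; apply; apply: lt_le_trans qa.
by rewrite /q_value; under eq_bigr do rewrite ba; rewrite ltrD2r.
Qed.

(** In a mixture of the same cost as [a], every action of positive weight is
    optimal and supported in [A], so its norm is at most that of [a].  The
    weighted sum of the squared distances to [a] is the mean of the squared
    norms minus the squared norm of [a], hence it is not positive: all actions
    of positive weight have the transitions of [a]. *)
Lemma extreme_not_replaceable A a : optimal a -> succs x a \subset A ->
  (forall c, optimal c -> succs x c \subset A ->
    \sum_y trans x c y * trans x c y <= \sum_y trans x a y * trans x a y) ->
  ~ replaceable x a.
Proof.
move=> [Aa qa] aA amax [b [[bx ba] nontriv cost_eq]].
have [Ab w0 w1] := bx.
pose p r y := trans x (@ract _ _ b r) y.
have q_b : \sum_r rweight r * (q_value U x (@ract _ _ b r) - U x) = 0.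
  under eq_bigr do rewrite mulrBr; rewrite sumrB -mulr_suml w1 mul1r -relaxed_q.
  have -> : \sum_y rtrans x b y * U y = \sum_y trans x a y * U y.
    by apply: eq_bigr => y _; rewrite ba.
  rewrite -cost_eq.
  by apply/eqP; rewrite subr_eq0 eq_le qa U_le_q.
have sq_le r : rweight r * \sum_y p r y * p r y <=
    rweight r * \sum_y trans x a y * trans x a y.
  have := w0 r; rewrite le_eqVlt => /predU1P[<-|wr0]; first by rewrite !mul0r.
  rewrite ler_wpM2l//; apply: amax.
    split => //; rewrite -subr_le0.
    have /eqP := q_b.
    rewrite psumr_eq0 => [/allP/(_ r (mem_index_enum _))|r' _].
      by rewrite /= mulf_eq0 (gt_eqF wr0)/= => /eqP ->.
    by rewrite mulr_ge0// subr_ge0 U_le_q.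
  apply: fintype.subset_trans aA; apply/fintype.subsetP => y.
  by rewrite !in_succs -ba; exact: relaxed_support.
have dist_le0 : \sum_r rweight r * \sum_y (p r y - trans x a y) ^+ 2 <= 0.
  have -> : \sum_r rweight r * \sum_y (p r y - trans x a y) ^+ 2 =
      \sum_r rweight r * \sum_y p r y * p r y -
      \sum_y trans x a y * trans x a y.
    transitivity (\sum_r (rweight r * (\sum_y p r y * p r y) +
       rweight r * (\sum_y trans x a y * trans x a y)) -
       2 * \sum_y (\sum_r rweight r * p r y) * trans x a y).
      under [X in 2 * X]eq_bigr do rewrite mulr_suml.
      rewrite exchange_big/= mulr_sumr -sumrB; apply: eq_bigr => r _.
      rewrite -mulrDr -big_split/= [2 * _]mulr_sumr mulr_sumr mulr_sumr -sumrB.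
      by apply: eq_bigr => y _; ring.
    under [X in _ - 2 * X]eq_bigr do rewrite [\sum_r _]ba.
    by rewrite big_split/= -mulr_suml w1 mul1r; ring.
  rewrite subr_le0 -[leRHS]mul1r -w1 mulr_suml.
  exact: ler_sum.
have [r wr0] : exists r, 0 < @rweight _ _ b r.
  apply: contrapT => /forallNP none; have := oner_neq0 R.
  rewrite -w1 big1 ?eqxx// => r _; apply/eqP.
  by rewrite eq_le w0 andbT leNgt; exact/negP/none.
apply: (nontriv r) => y; apply/eqP; rewrite -subr_eq0 -sqrf_eq0; apply/eqP.
have dist_ge0 r' : 0 <= \sum_y (p r' y - trans x a y) ^+ 2.
  by apply: sumr_ge0 => ? _; exact: sqr_ge0.
have /eqP : \sum_r rweight r * \sum_y (p r y - trans x a y) ^+ 2 = 0.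
  apply/eqP; rewrite eq_le dist_le0/=.
  by apply: sumr_ge0 => ? _; rewrite mulr_ge0.
rewrite psumr_eq0 => [/allP/(_ r (mem_index_enum _))|r' _];
  last by rewrite mulr_ge0.
rewrite /= mulf_eq0 (gt_eqF wr0)/= psumr_eq0 => [|? _]; last exact: sqr_ge0.
by move=> /allP/(_ y (mem_index_enum _))/eqP.
Qed.

Variable (delta : R).
Hypothesis (delta_ge0 : 0 <= delta).
Hypothesis (det_ge : forall a,
  useful x a -> deterministic x a -> delta <= cost x a).
Hypothesis (nondet_ge : forall a, useful x a -> ~~ deterministic x a ->
  forall z, z \in succs x a ->
    ((1 - trans x a z)%:E * convexified_cost x (oblique x a z)
       + (trans x a z * delta)%:E <= (cost x a)%:E)%E).

Lemma deterministic_trans a y : actions x a -> deterministic x a ->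
  y \in succs x a -> trans x a y = 1.
Proof.
move=> Aa /cards1P[z az]; rewrite az inE => /eqP ->.
rewrite -(trans_sum1 Aa) (bigD1 z)//= big1 ?addr0// => y' y'z.
apply/eqP; rewrite eq_le trans_ge0// andbT leNgt -in_succs az.
by rewrite inE.
Qed.

Lemma nondeterministic_lt1 a y : actions x a -> ~~ deterministic x a ->
  y \in succs x a -> trans x a y < 1.
Proof.
move=> Aa nd ya; rewrite ltNge; apply: contra nd => p1.
have py1 : trans x a y = 1.
  apply/eqP; rewrite eq_le p1 andbT -(trans_sum1 Aa) (bigD1 y)//= lerDl.
  by apply: sumr_ge0 => ? _; exact: trans_ge0.
apply/cards1P; exists y; apply/finset.setP => z; rewrite in_succs inE.
have [->|zy] := eqVneq z y; first by rewrite py1 ltr01.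
by rewrite (trans_eq0 Aa py1 zy) ltxx.
Qed.

(** The gap is the distance from [U x] to the minimum of [q_value] over the
    relatively closed set of actions supported in [A]; any [e] does if there
    are none. *)
Lemma support_gap A :
  (forall a, optimal a -> ~ succs x a \subset A) ->
  exists2 e, 0 < e & forall a, actions x a -> succs x a \subset A ->
    U x + e <= q_value U x a.
Proof.
move=> none; have [ne|emp] := pselect ((actions x `&` supported_in A) !=set0).
  have [a [Aa sa amin]] := lsc_attains_min (act_compact (x := x)) ne
    (@supported_in_closed A) (@lsc_q_value _ _ cost_lsc trans_cont U x).
  exists (q_value U x a - U x).
    rewrite subr_gt0 ltNge; apply/negP => qa; apply: (none a) => //.
    exact/supported_inP.
  by move=> c Ac /(supported_inP _ Ac) sc; rewrite subrKC amin.
exists 1 => // a Aa sa; exfalso; apply: emp; exists a; split => //.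
exact/supported_inP.
Qed.

(** A relaxed action with the transitions [oblique x a z] only mixes actions
    that avoid [z] and stay among the other successors of [a]. *)
Lemma convexified_cost_ge a z (c : R) :
  (forall a', actions x a' -> succs x a' \subset succs x a :\ z ->
    c <= q_value U x a') -> actions x a ->
  ((c - \sum_y oblique x a z y * U y)%:E
     <= convexified_cost x (oblique x a z))%E.
Proof.
move=> c_le Aa; apply: le_ereal_inf_tmp => _ [b [bx bq] <-].
rewrite lee_fin lerBlDr.
under eq_bigr do rewrite -bq.
apply: relaxed_q_ge => // r wr0; apply: c_le; first by case: bx.
apply/fintype.subsetP => y; rewrite in_succs => /(relaxed_support bx wr0).
rewrite bq /oblique finset.in_setD1 in_succs; case: eqP => [_|_ /=].
  by rewrite ltxx.
apply: contraLR; rewrite -!leNgt => p0; have /eqP -> : trans x a y == 0.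
  by rewrite eq_le p0 trans_ge0.
by rewrite mul0r.
Qed.

(** Take [a] optimal with a minimal set of successors, and extreme among such
    actions; then [a] is useful.  Deterministic case: [U x = cost x a + U y].
    Otherwise remove a successor [z].  By minimality no optimal action is left
    on the remaining successors, so each one there costs at least [U x + e] in
    total, and so does each relaxed action.  Substituted for the convexified
    cost in the hypothesis, this gives
    [(1 - xi) (U x + e) + xi (U z + delta) <= U x] with
    [xi = trans x a z].  The gap [e] makes the inequality strict, which is
    needed if [delta = 0], and replaces the attainment of the convexified
    cost. *)
Lemma causal_action : exists a, [/\ actions x a, q_value U x a <= U x &
  forall y, 0 < trans x a y -> U y < U x /\ U y + delta <= U x].
Proof.
have [A exA minA] := minimal_support.
have [a [opta aA amax]] := extreme_action exA.
have [Aa qa] := opta; exists a; split => // z; rewrite -in_succs => za.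
have usefula : useful x a.
  split => //; first exact: optimal_not_dominated.
  exact: extreme_not_replaceable amax.
have [deta|ndeta] := boolP (deterministic x a).
  have := qa; rewrite (q_value_det _ Aa (deterministic_trans Aa deta za)).
  have cost_gt0 := cost_pos xt Aa; have cost_ge := det_ge usefula deta.
  by move=> costU; split; lra.
have sa := minA _ opta aA.
have [c optc|e e0 gap] := @support_gap (succs x a :\ z).
  move=> cz; have /(minA c optc) : succs x c \subset A.
    by apply: fintype.subset_trans cz _; rewrite sa; exact: finset.subsetDl.
  move=> cA; move: cz; rewrite cA sa -{1}sa => /fintype.subsetP/(_ z za).
  by rewrite !inE eqxx.
have p1 := nondeterministic_lt1 Aa ndeta za.
have := za; rewrite in_succs => p0.
have := convexified_cost_ge gap Aa; set g := \sum_y _ => cge.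
have cost_ge :
    (1 - trans x a z) * (U x + e - g) + trans x a z * delta <= cost x a.
  rewrite -lee_fin; apply: le_trans (nondet_ge usefula ndeta za).
  by rewrite EFinD EFinM leeD2r// lee_wpmul2l// lee_fin subr_ge0 ltW.
have gE : (1 - trans x a z) * g = \sum_y trans x a y * U y - trans x a z * U z.
  rewrite /g [in RHS](bigD1 z)//= addrAC subrr add0r mulr_sumr (bigD1 z)//=.
  rewrite /oblique eqxx mul0r mulr0 add0r; apply: eq_bigr => y /negPf ->.
  by field; lra.
move: qa; rewrite /q_value => qa.
suff : trans x a z * (U z + delta) < trans x a z * U x.
  rewrite ltr_pM2l// => lt; split; last exact: ltW.
  by apply: le_lt_trans lt; rewrite lerDl.
have pe : 0 < (1 - trans x a z) * e by rewrite mulr_gt0// subr_gt0.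
by nra.
Qed.
End Causality.

(** * Label-setting methods *)

Section LabelSetting.
Context {R : realType} (S : ssp R).
Variables (U : node S -> R) (mu : node S -> act S).
Hypotheses (valueU : forall x, value x = (U x)%:E).
Hypotheses (U_ge0 : forall x, 0 <= U x) (U_target : U (target S) = 0).
Hypothesis (U_le_q : forall x a, actions x a -> U x <= q_value U x a).
Hypotheses (mu_control : control mu).
Hypothesis (mu_greedy : forall x, q_value U x (mu x) <= U x).
Hypothesis (mu_causal : forall x y,
  x != target S -> 0 < trans x (mu x) y -> U y < U x).
Implicit Types (s : state S) (x y z : node S) (a : act S) (B : {set node S}).

(** [label_le] needs no reference to the order in which nodes were accepted: an
    action is offered as a candidate when the last of its successors is. *)
Record label_invariant s : Prop := LabelInvariant {
  label_accepted : forall y, y \in accepted s -> label s y = (U y)%:E;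
  label_ge : forall y, ((U y)%:E <= label s y)%E;
  label_target : (label s (target S) <= 0)%E;
  label_le : forall x a, x \notin accepted s -> actions x a ->
    succs x a \subset accepted s -> (label s x <= (q_value U x a)%:E)%E
}.

Lemma initial_invariant : label_invariant (initial_state S).
Proof.
split=> /= [y|y||x a _ Aa]; rewrite ?inE//.
- by case: eqP => [->|_]; rewrite ?U_target ?leey.
- by rewrite eqxx.
rewrite finset.subset0 => /eqP succs0; exfalso.
have := oner_neq0 R; rewrite -(trans_sum1 Aa) big1 ?eqxx// => y _.
apply/eqP; rewrite eq_le trans_ge0// andbT leNgt; apply/negP => py.
by have := in_succs x a y; rewrite succs0 py inE.
Qed.

Lemma label_q_value (K : {set node S}) (V : node S -> \bar R) x a :
  actions x a -> (forall y, y \in K -> V y = (U y)%:E) -> succs x a \subset K ->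
  ((cost x a)%:E + \sum_y (trans x a y)%:E * V y)%E = (q_value U x a)%:E.
Proof.
move=> Aa VU /fintype.subsetP sub; rewrite /q_value EFinD -sumEFin.
congr (_ + _)%E; apply: eq_bigr => y _; rewrite EFinM.
have [ys|] := boolP (y \in succs x a); first by rewrite VU// sub.
(* A node outside [K] may have an infinite label, but its weight is 0. *)
rewrite inE -leNgt => p0; have /eqP -> : trans x a y == 0.
  by rewrite eq_le p0 trans_ge0.
by rewrite !mul0e.
Qed.

Lemma accept_invariant s B : label_invariant s ->
  (forall z, z \in B -> label s z = (U z)%:E) -> label_invariant (accept s B).
Proof.
move=> [acc ge tgt le] settled.
have KU y : y \in B :|: accepted s -> label s y = (U y)%:E.
  by rewrite finset.in_setU => /orP[/settled|/acc].
split=> /= [y yK|y||x a xK Aa sub].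
- by rewrite yK KU.
- case: ifP => // _; rewrite le_min ge/=.
  apply: le_ereal_inf_tmp => _ [a [Aa _ sub] <-].
  by rewrite (label_q_value Aa KU sub) lee_fin U_le_q.
- by case: ifP => // _; rewrite ge_min tgt.
rewrite (negPf xK) ge_min.
have [meet|/existsPn nmeet] := boolP [exists z in B, z \in succs x a].
  apply/orP; right; apply: ereal_inf_lbound.
  exists a; last exact: label_q_value KU sub.
  by split => //; have /existsP[z /andP[zB zs]] := meet; exists z.
apply/orP; left; apply: le => //.
  by apply: contra xK; rewrite finset.in_setU orbC => ->.
apply/fintype.subsetP => y ys; have := fintype.subsetP sub y ys.
rewrite finset.in_setU => /orP[yB|//].
by have := nmeet y; rewrite yB ys.
Qed.

Lemma label_settled s x : label_invariant s -> x \notin accepted s ->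
  (x != target S -> succs x (mu x) \subset accepted s) -> label s x = (U x)%:E.
Proof.
move=> [_ ge tgt le] xK sub; apply/eqP; rewrite eq_le ge andbT.
have [->|xt] := eqVneq x (target S); first by rewrite U_target.
by apply: le_trans (le x (mu x) xK (mu_control x) (sub xt)) _; rewrite lee_fin.
Qed.

(** Among the nodes not yet accepted, take one of smallest value.  If it is the
    target, its label is 0; otherwise all successors of its causal action are
    accepted, so its label is already correct. *)
Lemma frontier s y : label_invariant s -> y \notin accepted s ->
  exists x, [/\ x \notin accepted s, label s x = (U x)%:E &
    forall z, z \notin accepted s -> U x <= U z].
Proof.
move=> inv yK.
have [x /= xK xmin] :=
  @arg_minP _ _ _ y [pred z | z \notin accepted s] U yK.
exists x; split => //; apply: label_settled => // xt.
apply/fintype.subsetP => z; rewrite inE => /(mu_causal xt).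
apply: contraTT => zK; by rewrite -leNgt; exact: xmin.
Qed.

(** The common part of both methods: it is enough that steps exist before
    halting, and that a step accepts a nonempty set of nodes with correct
    labels.  The number of nodes not accepted then decreases, and by
    [frontier] a halted state has accepted all nodes. *)
Lemma settling_outputs (step : state S -> state S -> Prop) s :
  (forall s', label_invariant s' -> ~ halted s' -> exists s'', step s' s'') ->
  (forall s' s'', label_invariant s' -> step s' s'' -> exists B,
    [/\ B != finset.set0, forall z, z \in B -> z \notin accepted s',
        forall z, z \in B -> label s' z = (U z)%:E & s'' = accept s' B]) ->
  label_invariant s -> always_outputs step (@value R S) s.
Proof.
move=> progress settles.
have [n] := ubnP #|finset.setC (accepted s)|; elim: n s => // n IHn s sn inv.
have [hs|nhs] := pselect (halted s).
  apply: Outputs_halted => // y; rewrite valueU.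
  have [/(label_accepted inv)//|yK] := boolP (y \in accepted s).
  by have [x [/hs -> //]] := frontier inv yK.
apply: Outputs_step => //; first exact: progress.
move=> s' ss'; have [B [B0 BK BU ->]] := settles _ _ inv ss'.
apply: IHn; last exact: accept_invariant.
suff : finset.setC (accepted (accept s B)) \proper finset.setC (accepted s).
  by move=> /proper_card lt; exact: leq_trans lt sn.
have [z zB] := set0Pn _ B0.
have zK := BK z zB.
apply/properP; split; last by exists z; rewrite !inE ?zB.
by rewrite finset.setCS; exact: finset.subsetUr.
Qed.

Lemma not_halted s : ~ halted s ->
  exists2 y, y \notin accepted s & label s y != +oo%E.
Proof.
move=> nhs; apply: contrapT => none; apply: nhs => y yK.
by apply: contrapT => /eqP yfin; apply: none; exists y.
Qed.

(** The smallest label is at most the correct label of a node of smallest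
    value, hence it is correct as well. *)
Lemma dijkstra_outputs : dijkstra_applicable S.
Proof.
apply: settling_outputs initial_invariant
  => [s inv nhs|s _ inv [z [zK zfin zmin ->]]].
  have [y yK yfin] := not_halted nhs.
  have [z /= zK zmin] :=
    @arg_minP _ _ _ y [pred z | z \notin accepted s] (label s) yK.
  exists (accept s (finset.set1 z)), z; split => //.
  by apply: le_lt_trans (zmin y yK) _; rewrite ltey.
exists (finset.set1 z); split => //.
- by apply/set0Pn; exists z; rewrite inE.
- by move=> _ /finset.set1P ->.
move=> _ /finset.set1P ->; have [x [xK xU xmin]] := frontier inv zK.
apply/eqP; rewrite eq_le (label_ge inv) andbT.
by apply: le_trans (zmin x xK) _; rewrite xU lee_fin xmin.
Qed.

(** A node [x] of the lowest bucket [k] has [U x < (k + 1) delta], so the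
    successors of its causal action have values below [k delta] (the target is
    labelled 0).  If one of
    them were not accepted, [frontier] would provide a tentative node whose
    correct label lies in a lower bucket. *)
Lemma dial_outputs (delta : R) : 0 < delta ->
  (forall x y, x != target S -> 0 < trans x (mu x) y ->
     U y + delta <= U x) ->
  dial_applicable S delta.
Proof.
move=> delta_gt0 mu_delta.
have in_bucket s x (r : R) :
    0 <= r -> x \notin accepted s -> label s x = r%:E ->
    x \in bucket delta s (Num.truncn (r / delta)).
  move=> r0 xK xr; rewrite inE xK xr/= lee_fin lte_fin.
  rewrite -ler_pdivlMr// -ltr_pdivrMr//.
  by have := truncn_itv (divr_ge0 r0 (ltW delta_gt0)).
apply: settling_outputs initial_invariant
  => [s inv nhs|s _ inv [k [Bk0 lowest ->]]].
  have [y yK yfin] := not_halted nhs.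
  have ex : exists k, bucket delta s k != finset.set0.
    case labely: (label s y) yfin => [r||] // _; last first.
      by have := label_ge inv y; rewrite labely.
    have r0 : 0 <= r.
      by apply: le_trans (U_ge0 y) _; rewrite -lee_fin -labely (label_ge inv).
    exists (Num.truncn (r / delta)); apply/set0Pn; exists y.
    exact: in_bucket.
  case: (ex_minnP ex) => k Bk0 kmin.
  exists (accept s (bucket delta s k)), k; split => // j jk.
  by apply/eqP; apply: contraTT jk => /kmin; rewrite -leqNgt.
exists (bucket delta s k); split => //.
  by move=> x; rewrite inE => /and3P[].
move=> x; rewrite inE => /and3P[xK _ xlt].
apply: label_settled => // xt; apply/fintype.subsetP => y.
rewrite inE => /(mu_delta x y xt) yx.
apply: contraT => yK; have [x0 [x0K x0U x0min]] := frontier inv yK.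
have := in_bucket s x0 (U x0) (U_ge0 x0) x0K x0U; rewrite lowest ?inE//.
have xU : U x < k.+1%:R * delta.
  by rewrite -lte_fin; apply: le_lt_trans xlt; exact: label_ge.
have U0k : U x0 / delta < k%:R.
  rewrite ltr_pdivrMr//; apply: le_lt_trans (x0min y yK) _.
  rewrite -(ltrD2r delta); apply: le_lt_trans yx _.
  by move: xU; rewrite -natr1 mulrDl mul1r.
by rewrite truncn_lt_nat// divr_ge0// ltW.
Qed.
End LabelSetting.

Theorem theorem6 (R : realType) (S : ssp R) (delta : R)
  (HO : opportunistic S)
  (A1 : compact_actions S)
  (A2 : lsc_cost S)
  (A3 : continuous_trans S)
  (A4 : proper_policy_exists S)
  (A5 : positive_cost S)
  (A6 : no_self_transition S)
  (delta_ge0 : 0 <= delta)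
  (Hdet : forall (x : node S) (a : act S),
    x != target S -> useful x a -> deterministic x a ->
    delta <= cost x a)
  (Hndet : forall (x : node S) (a : act S),
    x != target S -> useful x a -> ~~ deterministic x a ->
    forall z : node S, z \in succs x a ->
    ((1 - trans x a z)%:E * convexified_cost x (oblique x a z)
       + (trans x a z * delta)%:E <= (cost x a)%:E)%E) :
  [/\ monotone_causal S, dijkstra_applicable S &
      0 < delta -> monotone_delta_causal S delta /\ dial_applicable S delta].
Proof.
pose U := @limit_value R S.
have U_le_q x a : actions x a -> U x <= q_value U x a.
  have [-> Aa|xt] := eqVneq x (target S); first by rewrite q_value_target.
  exact: limit_value_le_q.
have ex_mu x : exists a, [/\ actions x a, q_value U x a <= U x &
    x != target S -> forall y, 0 < trans x a y ->
      U y < U x /\ U y + delta <= U x].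
  have attained := limit_value_attained HO A1 A2 A3 A4 A5 x.
  have [xt|xt] := eqVneq x (target S).
    by have [a Aa qa] := attained; exists a; split.
  have [a [Aa qa causal]] := causal_action A1 A2 A3 A5 xt (U_le_q x) attained
    delta_ge0 (Hdet x ^~ xt) (fun a => Hndet x a xt).
  by exists a; split.
have [mu muP] := choice ex_mu.
have mu_control : control mu by move=> x; case: (muP x).
have mu_greedy x : q_value U x (mu x) <= U x by case: (muP x).
have mu_causal x y : x != target S -> 0 < trans x (mu x) y -> U y < U x.
  by case: (muP x) => _ _ /[apply] /(_ y)/[apply] -[].
have mu_delta x y : x != target S -> 0 < trans x (mu x) y -> U y + delta <= U x.
  by case: (muP x) => _ _ /[apply] /(_ y)/[apply] -[].
have mu_opt : optimal_stationary mu by exact: greedy_optimal.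
have valueU x : value x = (U x)%:E by exact: valueE.
have U_target : U (target S) = 0 by exact: limit_value_target.
have U_ge0 x : 0 <= U x by exact: limit_value_ge0.
split.
- by exists mu => // x y xt xy; rewrite !valueU lte_fin mu_causal.
- exact: (dijkstra_outputs valueU U_target U_le_q mu_control mu_greedy
    mu_causal).
move=> delta_gt0; split.
  by exists mu => // x y xt xy; rewrite !valueU -EFinD lee_fin mu_delta.
exact: (dial_outputs valueU U_ge0 U_target U_le_q mu_control mu_greedy
  mu_causal).
Qed.
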